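(* Let $k>0$, let $0<c<p$, let $T\ge 1$ be an integer, let $b_1>0$ and $a_1>\max(1,1/k)$, and let the demand-shape function be $\ell(y)=y^{k}$. Assume the set of feasible wholesale prices is $W=[\underline{w},\overline{w}]$ with $0<\underline{w}\le c<p\le\overline{w}$. Then: (a) There exists a standardized Markov perfect solution (SMPS). (b) There exists a Markov perfect equilibrium (MPE) of the dynamic wholesale-price game. (c) If $(w^*_t,\tilde z^*_t)_{1\le t\le T}$ is any SMPS with standardized value functions $(f^R_t,\hat f^R_t,f^M_t)_{1\le t\le T+1}$, and one defines, for $a\in A$, $b\in B$, $w\in W$, $$\tilde w_t(a,b):=w^*_t(a),\qquad \tilde q_t(a,b,w):=b^{1/k}\,\tilde z^*_t(a,w),$$ then $(\tilde w_t,\tilde q_t)_{1\le t\le T}$ is an MPE of the game, with value functions $$V^R_t(a,b)=\frac{b^{1/k}}{a-1}f^R_t(a),\qquad \hat V^R_t(a,b,w)=\frac{b^{1/k}}{a-1}\hat f^R_t(a,w),\qquad V^M_t(a,b)=\frac{b^{1/k}}{a-1}f^M_t(a).$$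
   Context: Setting. A manufacturer M and a retailer R interact over periods $t=1,\dots,T$. Retail price $p$ and unit production cost $c$ are fixed with $0<c<p$. The feasible wholesale prices form a set $W\subset(0,\infty)$ with $[c,p]\subset W$; feasible order quantities are $Q=[0,\infty)$. An unknown parameter $\Theta>0$ has Gamma prior density $\phi(\theta\mid a,b)=b^{a}\theta^{a-1}e^{-b\theta}/\Gamma(a)$; given $\Theta=\theta$ the demands $D_1,\dots,D_T$ are i.i.d. with $P(D_t\le y\mid\theta)=1-e^{-\theta\ell(y)}$, here $\ell(y)=y^k$. The predictive distribution function with hyperparameters $(a,b)$ is $G(y\mid a,b)=1-\big(b/(b+\ell(y))\big)^{a}$, $y\ge0$, and $\bar G=1-G$; $E[\,\cdot\mid a,b]$ denotes expectation with respect to $D\sim G(\cdot\mid a,b)$. Let $A=\{a_1+n:n=0,1,2,\dots\}$ and $B=[b_1,\infty)$. In each period the manufacturer chooses $w\in W$, the retailer observes it and orders $q\in Q$, sales $s=\min(D,q)$ are publicly observed (unmet demand is lost and unobserved), and the public belief state $(a,b)$ moves to $\Phi(a,b,q,d)=(a+\mathbf 1\{\min(d,q)<q\},\ b+\ell(\min(d,q)))$. Per-period payoffs: retailer $\Pi^R(w,q\mid a,b)=p\,E[\min(D,q)\mid a,b]-wq$; manufacturer $\Pi^M(w,q)=(w-c)q$. Markov strategies: for the manufacturer, Borel maps $w_t:A\times B\to W$; for the retailer, Borel maps $q_t:A\times B\times W\to Q$, $t=1,\dots,T$. A pair $(w^*_t,q^*_t)_{t\le T}$ is an MPE if there are functions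 $V^R_t,V^M_t:A\times B\to\mathbb R$, $\hat V^R_t:A\times B\times W\to\mathbb R$ ($t=1,\dots,T+1$) such that for all $a\in A,b\in B,w\in W$: (i) $V^R_{T+1}=\hat V^R_{T+1}=V^M_{T+1}=0$; (ii) for each $t\le T$, $\hat V^R_t(a,b,w)=\max_{q\in Q}\{\Pi^R(w,q\mid a,b)+E[V^R_{t+1}(\Phi(a,b,q,D))\mid a,b]\}$ and $q^*_t(a,b,w)$ attains this maximum; (iii) for each $t\le T$, $V^M_t(a,b)=\max_{w\in W}\{\Pi^M(w,q^*_t(a,b,w))+E[V^M_{t+1}(\Phi(a,b,q^*_t(a,b,w),D))\mid a,b]\}$ and $w^*_t(a,b)$ attains this maximum; (iv) $V^R_t(a,b)=\hat V^R_t(a,b,w^*_t(a,b))$. Standardized problem. Let $\tilde Q=[0,\infty)$. Standardized per-period payoffs: $\tilde\Pi^R(w,\tilde z\mid a)=(a-1)\big(p\,E[\min(D,\tilde z)\mid a,1]-w\tilde z\big)$ and $\tilde\Pi^M(w,\tilde z\mid a)=(a-1)(w-c)\tilde z$. For $f:A\to\mathbb R$, define $\mathcal E[f,\tilde z\mid a]=\frac{a-1}{a-1/k}G(\tilde z\mid a-1/k,1)f(a+1)+\bar G(\tilde z\mid a-1/k,1)f(a)$. Standardized Markov strategies are maps $w_t:A\to W$ and $\tilde z_t:A\times W\to\tilde Q$. A pair $(w^*_t,\tilde z^*_t)_{t\le T}$ is an SMPS if there are functions $f^R_t,f^M_t:A\to\mathbb R$, $\hat f^R_t:A\times W\to\mathbb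 R$ ($t=1,\dots,T+1$) such that for all $a\in A,w\in W$: (i) $f^R_{T+1}=\hat f^R_{T+1}=f^M_{T+1}=0$; (ii) $\hat f^R_t(a,w)=\max_{\tilde z\in\tilde Q}\{\tilde\Pi^R(w,\tilde z\mid a)+\mathcal E[f^R_{t+1},\tilde z\mid a]\}$ with $\tilde z^*_t(a,w)$ a maximizer; (iii) $f^M_t(a)=\max_{w\in W}\{\tilde\Pi^M(w,\tilde z^*_t(a,w)\mid a)+\mathcal E[f^M_{t+1},\tilde z^*_t(a,w)\mid a]\}$ with $w^*_t(a)$ a maximizer; (iv) $f^R_t(a)=\hat f^R_t(a,w^*_t(a))$. *)

(* Defs.v *)
From HB Require Import structures.
From mathcomp Require Import all_boot all_order all_algebra.
From mathcomp Require Import all_classical all_reals all_analysis.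
Set Implicit Arguments. Unset Strict Implicit. Unset Printing Implicit Defensive.
Import Order.TTheory GRing.Theory Num.Theory.
Import numFieldNormedType.Exports.
Local Open Scope classical_set_scope.
Local Open Scope ring_scope.

Section Game.
Variable R : realType.

Definition ell (k y : R) : R := y `^ k.

Definition inA (a1 a : R) : Prop := exists n : nat, a = a1 + n%:R.
Definition inB (b1 b : R) : Prop := b1 <= b.
Definition inW (wl wh w : R) : Prop := wl <= w <= wh.
Definition inQ (q : R) : Prop := 0 <= q.

Definition Gbar (k a b y : R) : R := (b / (b + ell k y)) `^ a.
Definition G (k a b y : R) : R := 1 - Gbar k a b y.

(* density of G on (0,oo): d/dy G(y|a,b) = a b^a l'(y) / (b+l(y))^(a+1) *)
Definition gdens (k a b y : R) : R :=
  a * b `^ a * (k * y `^ (k - 1)) / (b + ell k y) `^ (a + 1).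

Definition Expect (k a b : R) (h : R -> R) : \bar R :=
  (\int[@lebesgue_measure R]_(y in `[(0%R : R), +oo[%classic) (h y * gdens k a b y)%:E)%E.

Definition Phi (k a b q d : R) : R * R :=
  (a + (if Num.min d q < q then 1 else 0), b + ell k (Num.min d q)).

Definition objR (k p : R) (VRnext : R -> R -> R) (a b w q : R) : \bar R :=
  ((p%:E * Expect k a b (fun y => Num.min y q) - (w * q)%:E)
   + Expect k a b (fun y => VRnext (Phi k a b q y).1 (Phi k a b q y).2))%E.

Definition objM (k c : R) (VMnext : R -> R -> R) (a b w q : R) : \bar R :=
  (((w - c) * q)%:E
   + Expect k a b (fun y => VMnext (Phi k a b q y).1 (Phi k a b q y).2))%E.

Definition markov_strategies (a1 b1 wl wh : R) (T : nat)
    (w : nat -> R -> R -> R) (q : nat -> R -> R -> R -> R) : Prop :=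
  forall t : nat, (1 <= t <= T)%N ->
    measurable_fun ([set a | inA a1 a] `*` [set b | inB b1 b])
                   (fun x : R * R => w t x.1 x.2) /\
    measurable_fun (([set a | inA a1 a] `*` [set b | inB b1 b]) `*` [set w' | inW wl wh w'])
                   (fun x : (R * R) * R => q t x.1.1 x.1.2 x.2) /\
    (forall a b, inA a1 a -> inB b1 b -> inW wl wh (w t a b)) /\
    (forall a b w', inA a1 a -> inB b1 b -> inW wl wh w' -> inQ (q t a b w')).

Definition MPE_with (k p c a1 b1 wl wh : R) (T : nat)
    (w : nat -> R -> R -> R) (q : nat -> R -> R -> R -> R)
    (VR : nat -> R -> R -> R) (VRh : nat -> R -> R -> R -> R)
    (VM : nat -> R -> R -> R) : Prop :=
  markov_strategies a1 b1 wl wh T w q /\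
  forall a b w', inA a1 a -> inB b1 b -> inW wl wh w' ->
    (VR T.+1 a b = 0 /\ VRh T.+1 a b w' = 0 /\ VM T.+1 a b = 0) /\
    forall t : nat, (1 <= t <= T)%N ->
    ((VRh t a b w')%:E = objR k p (VR t.+1) a b w' (q t a b w') /\
     (forall q', inQ q' ->
        (objR k p (VR t.+1) a b w' q' <= objR k p (VR t.+1) a b w' (q t a b w'))%E)) /\
    ((VM t a b)%:E = objM k c (VM t.+1) a b (w t a b) (q t a b (w t a b)) /\
     (forall w'', inW wl wh w'' ->
        (objM k c (VM t.+1) a b w'' (q t a b w'')
         <= objM k c (VM t.+1) a b (w t a b) (q t a b (w t a b)))%E)) /\
    VR t a b = VRh t a b (w t a b).

Definition MPE (k p c a1 b1 wl wh : R) (T : nat)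
    (w : nat -> R -> R -> R) (q : nat -> R -> R -> R -> R) : Prop :=
  exists VR VRh VM, MPE_with k p c a1 b1 wl wh T w q VR VRh VM.

Definition stdPiR (k p : R) (a w z : R) : \bar R :=
  ((a - 1)%:E * (p%:E * Expect k a 1 (fun y => Num.min y z) - (w * z)%:E))%E.
Definition stdPiM (c : R) (a w z : R) : R := (a - 1) * (w - c) * z.
Definition stdE (k : R) (f : R -> R) (z a : R) : R :=
  (a - 1) / (a - k^-1) * G k (a - k^-1) 1 z * f (a + 1)
  + Gbar k (a - k^-1) 1 z * f a.

Definition SMPS_with (k p c a1 wl wh : R) (T : nat)
    (w : nat -> R -> R) (z : nat -> R -> R -> R)
    (fR : nat -> R -> R) (fRh : nat -> R -> R -> R) (fM : nat -> R -> R) : Prop :=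
  (forall t : nat, (1 <= t <= T)%N ->
     (forall a, inA a1 a -> inW wl wh (w t a)) /\
     (forall a w', inA a1 a -> inW wl wh w' -> inQ (z t a w'))) /\
  forall a w', inA a1 a -> inW wl wh w' ->
    (fR T.+1 a = 0 /\ fRh T.+1 a w' = 0 /\ fM T.+1 a = 0) /\
    forall t : nat, (1 <= t <= T)%N ->
    ((fRh t a w')%:E = (stdPiR k p a w' (z t a w') + (stdE k (fR t.+1) (z t a w') a)%:E)%E /\
     (forall z', inQ z' ->
        (stdPiR k p a w' z' + (stdE k (fR t.+1) z' a)%:E
         <= stdPiR k p a w' (z t a w') + (stdE k (fR t.+1) (z t a w') a)%:E)%E)) /\
    (fM t a = stdPiM c a (w t a) (z t a (w t a)) + stdE k (fM t.+1) (z t a (w t a)) a /\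
     (forall w'', inW wl wh w'' ->
        stdPiM c a w'' (z t a w'') + stdE k (fM t.+1) (z t a w'') a
        <= stdPiM c a (w t a) (z t a (w t a)) + stdE k (fM t.+1) (z t a (w t a)) a)) /\
    fR t a = fRh t a (w t a).

Definition SMPS (k p c a1 wl wh : R) (T : nat)
    (w : nat -> R -> R) (z : nat -> R -> R -> R) : Prop :=
  exists fR fRh fM, SMPS_with k p c a1 wl wh T w z fR fRh fM.

End Game.

(* Main.v *)
(* Beliefs enter only through the scale [b `^ k^-1]: stretching demand by this
   factor turns the predictive law with hyperparameters (a, b) into the one with
   (a, 1), so every Bellman equation of the game is [b `^ k^-1 / (a - 1)] times
   a standardized one.  The expected continuation value is explicit because
   [(b + y^k)^(1/k)] times the predictive density with shape [a] is, up to a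
   constant, the predictive density with shape [a - 1/k].

   A standardized solution exists by backward induction.  In one stage the
   retailer's payoff is continuous and, since [wl > 0], eventually below its
   value at 0, so optimal orders may be sought in a compact interval; the graph
   of the optimal-order correspondence over [wl, wh] is then compact, the
   manufacturer maximizes over this graph, and the retailer breaks ties in the
   manufacturer's favour at the maximizing price.

   Strategies obtained by scaling are Borel without any choice being made: [A]
   is countable, and any selection of optimal orders is nonincreasing in the
   wholesale price. *)
Require Import Defs.
From HB Require Import structures.
From mathcomp Require Import all_boot all_order all_algebra.
From mathcomp Require Import all_classical all_reals all_analysis.
From mathcomp Require Import measurable_realfun ring lra.
Import Order.TTheory GRing.Theory Num.Theory.
Import numFieldNormedType.Exports.
Local Open Scope classical_set_scope.
Local Open Scope ring_scope.

(** * Tail and density of the predictive law: derivative, continuity, limits *)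

Section Predictive.
Variables (R : realType) (k : R).
Hypothesis k_gt0 : 0 < k.

Lemma ell_ge0 (y : R) : 0 <= ell k y. Proof. exact: powR_ge0. Qed.

Lemma ell0 : ell k 0 = 0. Proof. by rewrite /ell powR0// gt_eqF. Qed.

Lemma addell_gt0 (b y : R) : 0 < b -> 0 < b + ell k y.
Proof. by move=> b0; rewrite ltr_wpDr ?ell_ge0. Qed.

(** Separating the powers of [b] and of [b + ell k y] reduces differentiation and changes of shape
    to the rules for powers. *)
Lemma GbarE (s b y : R) : 0 < b -> Gbar k s b y = b `^ s * (b + ell k y) `^ (- s).
Proof.
move=> b0; have bl := addell_gt0 b y b0.
by rewrite /Gbar powRM ?invr_ge0 ?(ltW b0) ?(ltW bl)// powRN -powR_inv1 ?ltW// -powRrM mulN1r powRN.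
Qed.

Lemma Gbar0 (s b : R) : 0 < b -> Gbar k s b 0 = 1.
Proof. by move=> b0; rewrite /Gbar ell0 addr0 divff ?gt_eqF// powR1. Qed.

Lemma Gbar_ge0 (s b y : R) : 0 <= Gbar k s b y. Proof. exact: powR_ge0. Qed.

Lemma Gbar_le1 (s b y : R) : 0 <= s -> 0 < b -> Gbar k s b y <= 1.
Proof.
move=> s0 b0; have bl := addell_gt0 b y b0.
rewrite /Gbar; have <- : 1 `^ s = 1 :> R by rewrite powR1.
apply: ge0_ler_powR; rewrite ?nnegrE ?divr_ge0 ?(ltW b0) ?(ltW bl)//.
by rewrite ler_pdivrMr// mul1r lerDl ell_ge0.
Qed.

Lemma gdens_ge0 (s b y : R) : 0 <= s -> 0 <= gdens k s b y.
Proof.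
by move=> s0; rewrite /gdens !mulr_ge0 ?invr_ge0 ?powR_ge0// ltW.
Qed.

Lemma is_derive_Gbar (s b y : R) : 0 < b -> 0 < y ->
  is_derive y 1 (Gbar k s b) (- gdens k s b y).
Proof.
move=> b0 y0; have bl := addell_gt0 b y b0.
have -> : Gbar k s b = b `^ s *: ((@powR R ^~ (- s)) \o (cst b + (@powR R ^~ k))).
  by apply/funext => x; rewrite GbarE//.
have d1 : is_derive y 1 (cst b + (@powR R ^~ k)) (k * y `^ (k - 1)).
  by rewrite -[X in is_derive _ _ _ X]add0r; apply: is_deriveD; exact: is_derive1_powR.
have d2 : is_derive ((cst b + (@powR R ^~ k)) y) 1 (@powR R ^~ (- s))
    (- s * (b + ell k y) `^ (- s - 1)) by exact: is_derive1_powR.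
have := is_deriveZ (b `^ s) (is_derive1_comp d2 d1).
rewrite (_ : b `^ s *: _ = - gdens k s b y)//.
rewrite /gdens -opprD powRN.
rewrite /GRing.scale/=; field; exact: lt0r_neq0 (powR_gt0 _ bl).
Qed.

Lemma continuous_Gbar (s b y : R) : 0 < b -> 0 < y -> {for y, continuous (Gbar k s b)}.
Proof.
move=> b0 y0; apply/differentiable_continuous/derivable1_diffP.
by have [] := is_derive_Gbar s b y b0 y0.
Qed.

Lemma continuous_powR_pos (r y : R) : 0 < y -> {for y, continuous (@powR R ^~ r)}.
Proof.
move=> y0; apply/differentiable_continuous/derivable1_diffP.
by have [] := is_derive1_powR r y0.
Qed.

Lemma continuous_gdens (s b y : R) : 0 < b -> 0 < y -> {for y, continuous (gdens k s b)}.
Proof.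
move=> b0 y0; have bl := addell_gt0 b y b0.
apply: cvgM.
  apply: cvgM; first exact: cvg_cst.
  by apply: cvgM; [exact: cvg_cst|exact: continuous_powR_pos].
apply: cvgV; first by rewrite gt_eqF// powR_gt0.
apply: (@cvg_comp _ _ _ _ (@powR R ^~ (s + 1)) _ (nbhs (b + ell k y))).
  by apply: cvgD; [exact: cvg_cst|exact: continuous_powR_pos].
exact: continuous_powR_pos.
Qed.

(** Precomposing with the absolute value changes nothing at nonnegative arguments and gives
    continuity on the whole line, including at 0, whatever [powR] does at negative bases. *)
Lemma continuous_normr_ell : continuous (fun y : R => ell k `|y|).
Proof.
move=> y; have [->|y0] := eqVneq y 0.
  apply/cvgrPdist_lt => /= e e0; rewrite normr0 ell0.
  near=> z; rewrite sub0r normrN ger0_norm ?ell_ge0//.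
  have -> : e = (e `^ k^-1) `^ k.
    by rewrite -powRrM mulVf ?gt_eqF// powRr1// ltW.
  apply: gt0_ltr_powR; rewrite ?nnegrE ?powR_ge0//.
  near: z; apply: (@cvgr_norm_lt _ _ _ _ _ id 0); first exact: cvg_id.
  by rewrite normr0 powR_gt0.
apply: (@cvg_comp _ _ _ _ (@powR R ^~ k) _ (nbhs `|y|)).
  exact: norm_continuous.
by apply: continuous_powR_pos; rewrite normr_gt0.
Unshelve. all: by end_near. Qed.

Lemma continuous_normr_Gbar (s b : R) : 0 < b -> continuous (fun y : R => Gbar k s b `|y|).
Proof.
move=> b0 y; have bl := addell_gt0 b `|y| b0.
apply: (@cvg_comp _ _ _ _ (@powR R ^~ s) _ (nbhs (b / (b + ell k `|y|)))); last first.
  by apply: continuous_powR_pos; rewrite divr_gt0.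
apply: cvgM; first exact: cvg_cst.
apply: cvgV; first by rewrite gt_eqF.
by apply: cvgD; [exact: cvg_cst|exact: continuous_normr_ell].
Qed.

Lemma cvg_at_right0_Gbar (s b : R) : 0 < b -> Gbar k s b y @[y --> 0^'+] --> (1 : R).
Proof.
move=> b0; rewrite -(Gbar0 s b b0) -[X in Gbar k s b X](normr0 R).
have /(_ _ _)/cvg_trans := @near_eq_cvg _ _ (0^'+ : set_system R) _
  (fun y : R => Gbar k s b `|y|) (Gbar k s b).
apply; first by near=> z; rewrite ger0_norm.
exact/cvg_at_right_filter/continuous_normr_Gbar.
Unshelve. all: by end_near. Qed.

Lemma cvg_pinfty_Gbar (s b : R) : 0 < s -> 0 < b -> Gbar k s b y @[y --> +oo] --> (0 : R).
Proof.
move=> s0 b0; apply/cvgrPdist_lt => /= e e0.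
near=> y; rewrite sub0r normrN ger0_norm ?Gbar_ge0//.
have -> : e = (e `^ s^-1) `^ s.
  by rewrite -powRrM mulVf ?gt_eqF// powRr1// ltW.
have bl := addell_gt0 b y b0.
have es0 : 0 < e `^ s^-1 by rewrite powR_gt0.
apply: gt0_ltr_powR; rewrite ?nnegrE ?powR_ge0// ?divr_ge0 ?(ltW b0) ?(ltW bl)//.
rewrite ltr_pdivrMr// mulrC -ltr_pdivrMr//.
(* The tail is below [e] as soon as [ell k y] exceeds [C], that is, as soon as [y] exceeds
   C^(1/k). *)
set C := b / _; have C0 : 0 < C by rewrite divr_gt0.
apply: (@lt_le_trans _ _ (ell k y)); last by rewrite lerDr ltW.
have -> : C = (C `^ k^-1) `^ k by rewrite -powRrM mulVf ?gt_eqF// powRr1// ltW.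
apply: gt0_ltr_powR; rewrite ?nnegrE ?powR_ge0//.
Unshelve. all: by end_near. Qed.

Lemma measurable_ell : measurable_fun [set: R] (ell k).
Proof. exact: measurable_powR. Qed.

Lemma measurable_gdens (s b : R) : measurable_fun [set: R] (gdens k s b).
Proof.
apply: measurable_funM.
  apply: measurable_funM => //; apply: measurable_funM => //; exact: measurable_powR.
have -> : (fun x : R => ((b + ell k x) `^ (s + 1))^-1) =
    (@powR R ^~ (- (s + 1))) \o (fun x => b + ell k x).
  by apply/funext => x /=; rewrite powRN.
apply: measurableT_comp; first exact: measurable_powR.
by apply: measurable_funD => //; exact: measurable_ell.
Qed.
End Predictive.

(** * Integrals over half-lines: truncation near 0 and linear substitution *)

Section Integrals.
Variable (R : realType).
Local Notation mu := (@lebesgue_measure R).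

(** Monotone convergence along an exhaustion of the open half-line. It keeps later computations away
    from 0, where the predictive density blows up if [k < 1]; the free factor [c] lets the cutoffs
    on both sides of a linear substitution correspond. *)
Lemma cvg_integral_itvcy0 (f : R -> \bar R) (c : R) : 0 < c ->
  measurable_fun `[(0%R : R), +oo[ f -> (forall x, 0 <= x -> (0 <= f x)%E) ->
  (\int[mu]_(x in `[(c * @harmonic R n)%R, +oo[) f x @[n --> \oo]
     --> \int[mu]_(x in `[(0%R : R), +oo[) f x)%E.
Proof.
move=> c0 mf f0.
have h0 n : 0 < c * harmonic n by rewrite mulr_gt0// invr_gt0.
have sub n : [set` `[c * harmonic n, +oo[] `<=` `[0, +oo[.
  by move=> x /=; rewrite !in_itv/= !andbT; apply: le_trans; exact: (ltW (h0 n)).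
rewrite -integral_itv_obnd_cbnd; last first.
  by apply: measurable_funS mf => // x /=; rewrite !in_itv/= !andbT; exact: ltW.
have -> : [set` `]0, +oo[] = \bigcup_n [set` `[c * harmonic n, +oo[].
  apply/seteqP; split => [x /=|x [n _]] /=; rewrite !in_itv/= !andbT.
    move=> x0; have : c * harmonic n @[n --> \oo] --> c * 0.
      by apply: cvgM; [exact: cvg_cst|exact: cvg_harmonic].
    rewrite mulr0 => /cvgr_lt /(_ _ x0)[N _ /(_ N (leqnn N)) /= Nx].
    by exists N => //=; rewrite in_itv/= andbT ltW.
  exact: (lt_le_trans (h0 n)).
apply: ge0_nondecreasing_set_cvg_integral => //.
- move=> m n mn; apply/subsetPset => x /=; rewrite !in_itv/= !andbT.
  by apply: le_trans; rewrite ler_pM2l// lef_pV2 ?posrE// ler_nat.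
- by move=> n; apply: measurable_funS (sub n) mf.
- by move=> n x /sub /=; rewrite in_itv/= andbT => /f0.
Qed.

Lemma continuous_within_itvcy (f : R -> R) (a : R) :
  (forall x, a <= x -> {for x, continuous f}) -> {within `[a, +oo[, continuous f}.
Proof.
move=> cf; apply: continuous_in_subspaceT => x.
by rewrite inE/= in_itv/= andbT => /cf.
Qed.

Lemma ge0_integral_itvcy_scale (f : R -> R) (c a : R) : 0 < c ->
  (forall x, c * a <= x -> {for x, continuous f}) ->
  (forall x, c * a <= x -> 0 <= f x) ->
  (\int[mu]_(x in `[(c * a)%R, +oo[) (f x)%:E =
   \int[mu]_(x in `[a, +oo[) (f (c * x) * c)%:E)%E.
Proof.
move=> c0 cf f0.
have dF (x : R) : is_derive x 1 ( *%R c) c.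
  by have := is_deriveZ c (is_derive_id x 1); rewrite /GRing.scale/= mulr1.
have F' : derive1 ( *%R c) = cst c.
  by apply/funext => x; rewrite derive1E; have [_ ->] := dF x.
have cF : continuous ( *%R c) by exact: mulrl_continuous.
rewrite (@increasing_ge0_integration_by_substitutiony _ ( *%R c) f a).
- by rewrite F'.
- by move=> x y _ _; rewrite ltr_pM2l.
- by rewrite F' => x _; exact: cvg_cst.
- by rewrite F'; exact: is_cvg_cst.
- by rewrite F'; exact: is_cvg_cst.
- split => [x _|]; first by have [] := dF x.
  exact/cvg_at_right_filter/cF.
- by apply: gt0_cvgMry => //; exact: cvg_id.
- exact: continuous_within_itvcy.
- by move=> x; rewrite in_itv/= andbT => /ltW /f0.
Qed.

End Integrals.

(** * Total mass and scaling of the predictive law *)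

Section Predictive.
Variables (R : realType) (k : R).
Hypothesis k_gt0 : 0 < k.
Local Notation mu := (@lebesgue_measure R).
Local Notation dom := (`[(0%R : R), +oo[%classic).

(** The negative of [Gbar] is an antiderivative of the density and vanishes at infinity, which
    settles [q > 0]. The case [q = 0] is a limit of truncated integrals, since the density need not
    be continuous at 0. *)
Lemma integral_gdens (s b q : R) : 0 < s -> 0 < b -> 0 <= q ->
  (\int[mu]_(y in `[q, +oo[) (gdens k s b y)%:E = (Gbar k s b q)%:E)%E.
Proof.
move=> s0 b0; have pos (r : R) : 0 < r ->
    (\int[mu]_(y in `[r, +oo[) (gdens k s b y)%:E = (Gbar k s b r)%:E)%E.
  move=> r0; rewrite (@ge0_continuous_FTC2y _ _ (\- Gbar k s b) r (- 0)).
  - by rewrite oppr0 sub0e -EFinN opprK.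
  - by move=> x _; apply: gdens_ge0 => //; exact: ltW.
  - apply: continuous_within_itvcy => x rx; apply: continuous_gdens => //.
    exact: lt_le_trans rx.
  - by apply: cvgN; exact: cvg_pinfty_Gbar.
  - move=> x rx; have [|] := is_deriveN (is_derive_Gbar R k s b x b0 _) => //.
    exact: lt_trans rx.
  - by apply: cvgN; apply: cvg_at_right_filter; exact: continuous_Gbar.
  - move=> x; rewrite in_itv/= andbT => rx; rewrite derive1E.
    have [|_ ->] := is_deriveN (is_derive_Gbar R k s b x b0 _).
      exact: lt_trans rx.
    by rewrite opprK.
rewrite le_eqVlt => /predU1P[<-|]; last exact: pos.
have := @cvg_integral_itvcy0 R (EFin \o gdens k s b) 1 ltr01.
move=> /(_ _ _)/cvg_lim <- //.
- apply/cvg_lim => //; rewrite Gbar0//.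
  have h0 n : 0 < 1 * harmonic n :> R by rewrite mul1r invr_gt0.
  under eq_cvg do rewrite /comp pos//.
  apply: cvg_EFin; first by near=> n.
  apply: (@cvg_comp _ _ _ (fun n => 1 * harmonic n) (Gbar k s b) _ (0^'+)); last first.
    exact: cvg_at_right0_Gbar.
  move=> A A0; have [N _ NA] := @cvg_harmonic R _ A0.
  by exists N => // n Nn /=; rewrite mul1r; apply: (NA n Nn); rewrite /= invr_gt0.
- by apply/measurable_EFinP; apply: measurable_funTS; exact: measurable_gdens.
- by move=> x _; rewrite lee_fin gdens_ge0// ltW.
Unshelve. all: by end_near. Qed.

(** Stretching the argument by b^(1/k) multiplies [ell] by [b], so demand divided by b^(1/k) has
    hyperparameters [(a, 1)]; the extra factor on the left is the Jacobian. *)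
Lemma gdens_scale (a b u : R) : 0 < b -> 0 <= u ->
  gdens k a b (b `^ k^-1 * u) * b `^ k^-1 = gdens k a 1 u.
Proof.
move=> b0 u0; have s0 : 0 < b `^ k^-1 by rewrite powR_gt0.
have kn0 : k != 0 by rewrite gt_eqF.
have ell_s : ell k (b `^ k^-1 * u) = b * ell k u.
  by rewrite /ell powRM ?powR_ge0// -powRrM mulVf// powRr1// ltW.
rewrite /gdens ell_s.
have -> : b + b * ell k u = b * (1 + ell k u) by ring.
rewrite (@powRM _ b) ?(ltW b0) ?addr_ge0 ?ell_ge0//.
rewrite (@powRM _ _ u) ?powR_ge0// -powRrM powR1 !mulr1.
have -> : k^-1 * (k - 1) = 1 - k^-1 by field.
rewrite powRB; last by rewrite (gt_eqF b0) implybT.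
rewrite powRr1; last exact: ltW.
rewrite (@powRD _ b a 1); last by rewrite (gt_eqF b0) implybT.
rewrite powRr1; last exact: ltW.
field; rewrite !gt_eqF ?powR_gt0//.
by rewrite addell_gt0.
Qed.

Lemma measurable_min_gdens (a b q : R) :
  measurable_fun [set: R] (fun y => Num.min y q * gdens k a b y).
Proof.
apply: measurable_funM; last exact: measurable_gdens.
exact: measurable_minr.
Qed.

Lemma Expect_min_scale (a b z : R) : 0 < a -> 0 < b -> 0 <= z ->
  Expect k a b (fun y => Num.min y (b `^ k^-1 * z)) =
  ((b `^ k^-1)%:E * Expect k a 1 (fun y => Num.min y z))%E.
Proof.
move=> a0 b0 z0; set c := b `^ k^-1.
have c0 : 0 < c by rewrite powR_gt0.
have f0 b' q x : 0 <= q -> 0 <= x -> 0 <= Num.min x q * gdens k a b' x.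
  by move=> q0 x0; rewrite mulr_ge0 ?gdens_ge0 ?(ltW a0)// le_min x0.
have cz0 : 0 <= c * z by rewrite mulr_ge0// ltW.
rewrite /Expect -ge0_integralZl_EFin//; last 3 first.
- by move=> x /=; rewrite in_itv/= andbT => x0; rewrite lee_fin f0.
- by apply/measurable_EFinP; apply: measurable_funTS; exact: measurable_min_gdens.
- exact: ltW.
(* The two sides are truncated at [c * harmonic n] and at [harmonic n], so that the substitution y =
   c u identifies them for every [n]. *)
have := @cvg_integral_itvcy0 R (fun y => (Num.min y (c * z) * gdens k a b y)%:E) _ c0.
move=> /(_ _ _)/cvg_lim <- //; last 2 first.
- by apply/measurable_EFinP; apply: measurable_funTS; exact: measurable_min_gdens.
- by move=> x x0; rewrite lee_fin f0.
have := @cvg_integral_itvcy0 R (fun y => (c%:E * (Num.min y z * gdens k a 1 y)%:E)%E) _ ltr01.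
move=> /(_ _ _)/cvg_lim <- //; last 2 first.
- apply: measurable_funeM.
  by apply/measurable_EFinP; apply: measurable_funTS; exact: measurable_min_gdens.
- by move=> x x0; rewrite mule_ge0// lee_fin ?f0// ltW.
apply: congr_lim; apply/funext => n.
have h0 : 0 < harmonic n :> R by rewrite invr_gt0.
rewrite mul1r ge0_integral_itvcy_scale//.
- apply: eq_integral => x; rewrite inE/= in_itv/= andbT => hx.
  have x0 : 0 <= x by apply: le_trans hx; exact: ltW.
  rewrite -EFinM -minr_pMr; last exact: ltW.
  by congr EFin; rewrite -(gdens_scale a b x)// -/c; ring.
- move=> x hx; have x0 : 0 < x by apply: lt_le_trans hx; rewrite mulr_gt0.
  apply: cvgM; last exact: continuous_gdens.
  by apply: (@continuous_min _ _ id (cst (c * z))); [exact: cvg_id|exact: cvg_cst].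
- move=> x hx; apply: f0 => //; apply: le_trans hx.
  by rewrite mulr_ge0// ltW.
Qed.
End Predictive.

(** * Expected sales as a real function of the order *)

Section Sales.
Variables (R : realType) (k : R).
Hypothesis k_gt0 : 0 < k.
Local Notation mu := (@lebesgue_measure R).
Local Notation dom := (`[(0%R : R), +oo[%classic).

Lemma itv0y_split (q : R) : 0 <= q -> dom = `[0, q[ `|` `[q, +oo[.
Proof.
move=> q0; apply/seteqP; split => x /=; rewrite !in_itv/= !andbT.
  by move=> x0; have [xq|xq] := ltP x q; [left; rewrite x0|right].
by case=> [/andP[]//|]; exact: le_trans.
Qed.

Lemma disjoint_itv0y (q : R) : [disjoint `[0, q[%classic & `[q, +oo[%classic].
Proof.
rewrite disj_set2E; apply/eqP/seteqP; split => x //= -[].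
by rewrite !in_itv/= andbT => /andP[_ xq]; rewrite leNgt xq.
Qed.

Lemma integral_gdens_lt (s b q : R) : 0 < s -> 0 < b -> 0 <= q ->
  (\int[mu]_(y in `[0%R, q[) (gdens k s b y)%:E = (G k s b q)%:E)%E.
Proof.
move=> s0 b0 q0; have := integral_gdens R k k_gt0 s b 0 s0 b0 (lexx _).
rewrite Gbar0// (itv0y_split _ q0) integral_setU//; last 2 first.
- by apply/measurable_EFinP; apply: measurable_funTS; exact: measurable_gdens.
- exact: disjoint_itv0y.
rewrite integral_gdens// /G EFinB => <-.
by rewrite addeK.
Qed.

Lemma integrable_gdens (s b q : R) : 0 < s -> 0 < b -> 0 <= q ->
  mu.-integrable `[q, +oo[ (EFin \o gdens k s b).
Proof.
move=> s0 b0 q0; apply/integrableP; split.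
  by apply/measurable_EFinP; apply: measurable_funTS; exact: measurable_gdens.
under eq_integral do rewrite /= ger0_norm ?(gdens_ge0 R k k_gt0) ?(ltW s0)//.
by rewrite integral_gdens// ltry.
Qed.

Lemma integrable_EFinZl (D : set R) (c : R) (f : R -> R) : measurable D ->
  mu.-integrable D (EFin \o f) -> mu.-integrable D (EFin \o (fun y => c * f y)).
Proof.
move=> mD fi; rewrite (_ : EFin \o _ = (fun y => c%:E * (EFin \o f) y)%E)//.
exact: integrableZl.
Qed.

(** For [y >= 0] the absolute value of [Num.min y q] is at most that of [q], whatever the sign of
    [q], so a multiple of the density dominates. *)
Lemma integrable_min_gdens (s b q : R) : 0 < s -> 0 < b ->
  mu.-integrable dom (EFin \o (fun y => Num.min y q * gdens k s b y)).
Proof.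
move=> s0 b0; have : mu.-integrable dom (EFin \o (fun y => q * gdens k s b y)).
  by apply: integrable_EFinZl => //; exact: integrable_gdens.
apply: le_integrable => //.
  by apply/measurable_EFinP; apply: measurable_funTS; exact: measurable_min_gdens.
move=> y /=; rewrite in_itv/= andbT => y0.
rewrite lee_fin !normrM ler_wpM2r//.
have [yq|yq] := leP y q => //.
by rewrite !ger0_norm// (le_trans y0).
Qed.

(** A real-valued form of the extended-real [Expect], so that payoffs can be handled by real algebra
    and continuity. *)
Definition mean_sales (a z : R) : R :=
  (\int[mu]_(y in dom) (Num.min y z * gdens k a 1 y))%R.

Lemma Expect_minE (a z : R) : 0 < a ->
  Expect k a 1 (fun y => Num.min y z) = (mean_sales a z)%:E.
Proof.
move=> a0; rewrite /mean_sales /Rintegral fineK//.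
exact: integrable_fin_num (integrable_min_gdens _ _ _ _ _).
Qed.

Lemma Rintegral_gdens (s q : R) : 0 < s -> 0 <= q ->
  (\int[mu]_(y in `[q, +oo[) (gdens k s 1 y))%R = Gbar k s 1 q.
Proof. by move=> s0 q0; rewrite /Rintegral integral_gdens. Qed.

(** Pointwise, [Num.min y z] is nondecreasing and 1-Lipschitz in [z]; integrating against a density
    of total mass 1 preserves both. *)
Lemma mean_sales_lipschitz (a z z' : R) : 0 < a -> z' <= z ->
  mean_sales a z' <= mean_sales a z <= mean_sales a z' + (z - z').
Proof.
move=> a0 zz'; have g0 y := gdens_ge0 R k k_gt0 a 1 y (ltW a0).
have ig := integrable_gdens a 1 0 a0 ltr01 (lexx _).
have im q := integrable_min_gdens a 1 q a0 ltr01.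
apply/andP; split.
  apply: le_Rintegral => // y _; rewrite ler_wpM2r//.
  by rewrite le_min ge_min lexx/= ge_min zz' orbT.
have -> : z - z' = (\int[mu]_(y in dom) ((z - z') * gdens k a 1 y))%R.
  by rewrite RintegralZl// Rintegral_gdens// Gbar0// mulr1.
rewrite -RintegralD//; last exact: integrable_EFinZl.
apply: le_Rintegral => //.
  by apply: (@integrableD _ _ _ mu dom _ (EFin \o _) (EFin \o _)) => //;
    exact: integrable_EFinZl.
move=> y _; rewrite -mulrDl ler_wpM2r//.
by case: (leP y z); case: (leP y z') => *; lra.
Qed.

Lemma continuous_mean_sales (a : R) : 0 < a -> continuous (mean_sales a).
Proof.
move=> a0 z; apply/cvgrPdist_le => /= e e0; near=> x.
apply: (@le_trans _ _ `|z - x|); last first.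
  near: x; exact: cvgr_dist_le.
have [zx|/ltW zx] := leP z x.
  have /andP[h1 h2] := mean_sales_lipschitz a x z a0 zx.
  by rewrite !ler0_norm; lra.
have /andP[h1 h2] := mean_sales_lipschitz a z x a0 zx.
by rewrite !ger0_norm; lra.
Unshelve. all: by end_near. Qed.

(** Sales are at most [M] when demand is below [M] and at most [z] otherwise. A large [M] makes the
    slope of this bound in [z] as small as desired, so purchase costs eventually dominate
    revenue. *)
Lemma mean_sales_le (a z M : R) : 0 < a -> 0 <= z -> 0 <= M ->
  mean_sales a z <= M + z * Gbar k a 1 M.
Proof.
move=> a0 z0 M0; have g0 y := gdens_ge0 R k k_gt0 a 1 y (ltW a0).
have ig q := integrable_gdens a 1 q a0 ltr01.
have im := integrable_min_gdens a 1 z a0 ltr01.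
have sub1 : `[0, M[ `<=` dom by rewrite (itv0y_split _ M0); left.
have sub2 : `[M, +oo[ `<=` dom by rewrite (itv0y_split _ M0); right.
have igM : mu.-integrable `[0%R, M[ (EFin \o gdens k a 1).
  by apply: (@integrableS _ _ _ mu dom _ _ _ _ sub1) => //; exact: ig.
have := Rintegral_gdens a 0 a0 (lexx _).
rewrite Gbar0// {1}(itv0y_split _ M0) Rintegral_setU//; last 2 first.
- by rewrite -itv0y_split//; exact: ig.
- exact: disjoint_itv0y.
rewrite Rintegral_gdens// => g1.
have Gb0 : 0 <= Gbar k a 1 M by exact: Gbar_ge0.
rewrite /mean_sales (itv0y_split _ M0) Rintegral_setU//; last 2 first.
- by rewrite -itv0y_split.
- exact: disjoint_itv0y.
apply: (@le_trans _ _ (M * (\int[mu]_(y in `[0%R, M[) gdens k a 1 y)%R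
   + z * Gbar k a 1 M)); last first.
  by rewrite lerD2r ler_piMr//; lra.
rewrite -(Rintegral_gdens a M)// -!RintegralZl//; last exact: ig.
apply: lerD; apply: le_Rintegral => //.
- by apply: (@integrableS _ _ _ mu dom _ _ _ _ sub1).
- exact: integrable_EFinZl.
- move=> y /=; rewrite in_itv/= => /andP[y0 yM].
  by rewrite ler_wpM2r// ge_min (ltW yM).
- by apply: (@integrableS _ _ _ mu dom _ _ _ _ sub2).
- by apply: integrable_EFinZl => //; exact: ig.
- by move=> y _; rewrite ler_wpM2r// ge_min lexx orbT.
Qed.

End Sales.

(** * Expected continuation values in closed form *)

Section Continuation.
Variables (R : realType) (k : R).
Hypothesis k_gt0 : 0 < k.
Local Notation mu := (@lebesgue_measure R).
Local Notation dom := (`[(0%R : R), +oo[%classic).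

Lemma ell_scale (b z : R) : 0 < b -> 0 <= z -> ell k (b `^ k^-1 * z) = b * ell k z.
Proof.
move=> b0 z0.
by rewrite /ell powRM ?powR_ge0// -powRrM mulVf ?gt_eqF// powRr1// ltW.
Qed.

Lemma Gbar_scale (s b z : R) : 0 < b -> 0 <= z ->
  Gbar k s b (b `^ k^-1 * z) = Gbar k s 1 z.
Proof.
move=> b0 z0; rewrite /Gbar ell_scale//.
have h : 1 + ell k z != 0 by rewrite gt_eqF// addell_gt0.
congr (_ `^ _); field.
rewrite h (_ : b + b * ell k z = b * (1 + ell k z)); last by ring.
by rewrite mulf_neq0// gt_eqF.
Qed.

(** The factor (b + y^k)^(1/k) only lowers the exponent of the denominator by 1/k. The divisor [a]
    is what the value factor 1/(a - 1) becomes after an uncensored observation raises the shape to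
    [a + 1]. *)
Lemma gdens_shift (a b y : R) : 0 < b -> a != 0 -> a - k^-1 != 0 ->
  (b + ell k y) `^ k^-1 / a * gdens k a b y =
  b `^ k^-1 / (a - k^-1) * gdens k (a - k^-1) b y.
Proof.
move=> b0 a0 s0; have l0 := addell_gt0 R k b y b0.
rewrite /gdens.
have -> : b `^ a = b `^ k^-1 * b `^ (a - k^-1).
  by rewrite -powRD ?(gt_eqF b0) ?implybT//; congr (_ `^ _); ring.
have -> : (b + ell k y) `^ (a + 1) =
    (b + ell k y) `^ k^-1 * (b + ell k y) `^ (a - k^-1 + 1).
  by rewrite -powRD ?(gt_eqF l0) ?implybT//; congr (_ `^ _); ring.
move: (a - k^-1) s0 => s s0; field.
by rewrite !(gt_eqF (powR_gt0 _ l0)) a0 s0.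
Qed.

(** The counterpart of the density shift for the event of a stockout. *)
Lemma Gbar_shift (a b y : R) : 0 < b ->
  (b + ell k y) `^ k^-1 * Gbar k a b y = b `^ k^-1 * Gbar k (a - k^-1) b y.
Proof.
move=> b0; have l0 := addell_gt0 R k b y b0; rewrite !GbarE//.
have -> : b `^ a = b `^ k^-1 * b `^ (a - k^-1).
  by rewrite -powRD ?(gt_eqF b0) ?implybT//; congr (_ `^ _); ring.
have -> : (b + ell k y) `^ (- (a - k^-1)) =
    (b + ell k y) `^ k^-1 * (b + ell k y) `^ (- a).
  by rewrite -powRD ?(gt_eqF l0) ?implybT//; congr (_ `^ _); ring.
ring.
Qed.

(** Split at the order [q]. Below it the next shape is [a + 1] and the integrand is a constant [c1]
    times the density of shape a - 1/k; from [q] on, sales are censored, the next state is fixed,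
    and the integrand is a constant [c2] times the original density. *)
Lemma Expect_continuation (f : R -> R) (a b z : R) :
  1 < a -> k^-1 < a -> 0 < b -> 0 <= z ->
  Expect k a b (fun y =>
    (Phi k a b (b `^ k^-1 * z) y).2 `^ k^-1
      / ((Phi k a b (b `^ k^-1 * z) y).1 - 1)
      * f (Phi k a b (b `^ k^-1 * z) y).1)
  = (b `^ k^-1 / (a - 1) * stdE k f z a)%:E.
Proof.
move=> a1 ak b0 z0; set q := b `^ k^-1 * z.
have q0 : 0 <= q by rewrite mulr_ge0// powR_ge0.
have s0 : 0 < a - k^-1 by rewrite subr_gt0.
have a0 : 0 < a by apply: lt_trans a1.
set c1 := b `^ k^-1 / (a - k^-1) * f (a + 1).
set c2 := (b + ell k q) `^ k^-1 / (a - 1) * f a.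
rewrite /Expect; set h := (fun y : R => (_ * gdens k a b y)%:E).
have h1 y : y \in `[0%R, q[%classic -> h y = (c1 * gdens k (a - k^-1) b y)%:E.
  rewrite inE/= in_itv/= => /andP[y0 yq]; rewrite /h /Phi/=.
  rewrite (min_idPl (ltW yq)) yq (_ : a + 1 - 1 = a); last by ring.
  rewrite /c1; congr EFin.
  rewrite mulrAC gdens_shift ?(gt_eqF a0) ?(gt_eqF s0)//; ring.
have h2 y : y \in `[q, +oo[%classic -> h y = (c2 * gdens k a b y)%:E.
  rewrite inE/= in_itv/= andbT => qy; rewrite /h /Phi/=.
  by rewrite (min_idPr qy) ltxx addr0.
have m1 (D : set R) c s : measurable_fun D (fun y => (c * gdens k s b y)%:E).
  apply/measurable_EFinP; apply: measurable_funM => //.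
  by apply: measurable_funTS; exact: measurable_gdens.
rewrite (itv0y_split _ _ q0) integral_setU//; last 2 first.
- apply/measurable_funU => //; split.
  + by apply: eq_measurable_fun (m1 _ c1 (a - k^-1)) => y /h1.
  + by apply: eq_measurable_fun (m1 _ c2 a) => y /h2.
- exact: disjoint_itv0y.
have -> : (\int[mu]_(y in `[0%R, q[) h y
    = \int[mu]_(y in `[0%R, q[) (c1%:E * (gdens k (a - k^-1) b y)%:E))%E.
  by apply: eq_integral => y /h1.
have -> : (\int[mu]_(y in `[q, +oo[) h y
    = \int[mu]_(y in `[q, +oo[) (c2%:E * (gdens k a b y)%:E))%E.
  by apply: eq_integral => y /h2.
rewrite !integralZl//; last 2 first.
- exact: integrable_gdens.
- apply: (@integrableS _ _ _ mu dom) => //.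
    by move=> y /=; rewrite !in_itv/= andbT => /andP[].
  exact: integrable_gdens.
rewrite integral_gdens_lt// integral_gdens// -!EFinM -EFinD; congr EFin.
have -> : c2 * Gbar k a b q = b `^ k^-1 / (a - 1) * Gbar k (a - k^-1) b q * f a.
  have := Gbar_shift a b q b0; rewrite /c2 => e.
  transitivity ((b + ell k q) `^ k^-1 * Gbar k a b q / (a - 1) * f a); first by ring.
  by rewrite e; ring.
rewrite /stdE /G !Gbar_scale// /c1; move: (a - k^-1) s0 => s s0; field.
by rewrite (gt_eqF s0) subr_eq0 gt_eqF.
Qed.
End Continuation.

(** * Existence of a standardized solution *)

Section Existence.
Variable R : realType.

(** Along an arbitrary selection of best replies [v] may jump and fail to attain its supremum. Over
    all pairs of a price and a best reply in [[0, M]] the maximum exists, by compactness. *)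
Lemma leader_follower_equilibrium (wl wh M : R) (u v : R * R -> R) :
  wl <= wh -> 0 <= M -> continuous u -> continuous v ->
  (forall w z, wl <= w <= wh -> M < z -> u (w, z) <= u (w, 0)) ->
  exists (w0 : R) (zs : R -> R),
    [/\ wl <= w0 <= wh,
        forall w, wl <= w <= wh ->
          0 <= zs w /\ forall z, 0 <= z -> u (w, z) <= u (w, zs w) &
        forall w, wl <= w <= wh -> v (w, zs w) <= v (w0, zs w0)].
Proof.
move=> wlh M0 cu cv coer.
have cpair (w : R) : continuous (fun z : R => (w, z)).
  by move=> z; apply: (@cvg_pair _ _ _ _ (nbhs w) (nbhs z)); [exact: cvg_cst|exact: cvg_id].
have ex w : exists z, wl <= w <= wh ->
    0 <= z <= M /\ forall z', 0 <= z' -> u (w, z') <= u (w, z).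
  have [z zM zmax] : exists2 z, z \in `[0, M] &
      forall t, t \in `[0, M] -> u (w, t) <= u (w, z).
    apply: (@EVT_max _ (fun z => u (w, z))) => //.
    apply: continuous_subspaceT => z.
    by apply: (@continuous_comp _ _ _ (fun z : R => (w, z)) u); [exact: cpair|exact: cu].
  exists z => wW; split; first by move: zM; rewrite in_itv.
  move=> z' z'0; have [z'M|Mz'] := leP z' M.
    by apply: zmax; rewrite in_itv/= z'0.
  apply: (le_trans (coer _ _ wW Mz')); apply: zmax.
  by rewrite in_itv/= lexx.
have [zz zzP] := choice ex.
(* The graph of best replies is a compact box cut by one closed condition for each competing order
   [z]; continuity of the reply is not involved. *)
pose A := ([set` `[wl, wh]] `*` [set` `[(0 : R), M]]) `&`
  \bigcap_(z in [set z : R | 0 <= z]) [set x : R * R | u (x.1, z) <= u x].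
have Az w : wl <= w <= wh -> A (w, zz w).
  move=> wW; have [zM zmax] := zzP w wW; split; last by move=> z /= z0; exact: zmax.
  by split; rewrite /= in_itv.
have cA : compact A.
  apply: compact_closedI; first by apply: compact_setX; exact: segment_compact.
  apply: closed_bigI => z _.
  rewrite (_ : [set _ | _] = (fun x => u x - u (x.1, z)) @^-1` [set r | 0 <= r]).
    apply: preimage_closed; last exact: closed_ge.
    move=> x _; apply: cvgB; first exact: cu.
    apply: (@continuous_comp _ _ _ (fun x : R * R => (x.1, z)) u); last exact: cu.
    by apply: (@cvg_pair _ _ _ _ (nbhs x.1) (nbhs z)); [exact: cvg_fst|exact: cvg_cst].
  by apply/seteqP; split => x /=; rewrite subr_ge0.
have A0 : A !=set0 by exists (wl, zz wl); apply: Az; rewrite lexx.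
have [[w0 z0] /set_mem w0A vmax] := compact_EVT_max A0 cA (continuous_subspaceT cv).
have [[/= w0W z0M] z0max] := w0A.
rewrite in_itv/= in w0W; rewrite in_itv/= in z0M; have /andP[z00 _] := z0M.
(* Changing the selection at the single price [w0] is enough: every other pair still lies in [A],
   over which [(w0, z0)] is maximal. *)
exists w0, (fun w => if w == w0 then z0 else zz w); split => //.
- move=> w wW; case: eqP => [->|_].
    by split => // z zge0; exact: (z0max z).
  by have [/andP[z1 _] ?] := zzP w wW.
- move=> w wW; rewrite eqxx; apply: vmax; apply/mem_set.
  by case: eqP => [->//|_]; exact: Az.
Qed.

Variables (k p c wl wh : R).
Hypotheses (k_gt0 : 0 < k) (p_gt0 : 0 < p) (wl_gt0 : 0 < wl) (wlh : wl <= wh).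

Lemma continuous_stdE (f : R -> R) (a : R) :
  continuous (fun z : R => stdE k f `|z| a).
Proof.
have cG := continuous_normr_Gbar R k k_gt0 (a - k^-1) 1 ltr01.
move=> z; apply: cvgD.
  apply: cvgM; last exact: cvg_cst.
  apply: cvgM; first exact: cvg_cst.
  by apply: cvgB; [exact: cvg_cst|exact: cG].
by apply: cvgM; [exact: cG|exact: cvg_cst].
Qed.

(** The weights of [f (a + 1)] and [f a] involve [z] only through probabilities, so the bound is
    uniform in the order. *)
Lemma stdE_bounded (f : R -> R) (a z : R) : 1 < a -> k^-1 < a ->
  `|stdE k f z a| <= (a - 1) / (a - k^-1) * `|f (a + 1)| + `|f a|.
Proof.
move=> a1 ak; have s0 : 0 < a - k^-1 by rewrite subr_gt0.
have G0 := Gbar_ge0 R k (a - k^-1) 1 z.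
have G1 := Gbar_le1 R k (a - k^-1) 1 z (ltW s0) ltr01.
apply: (le_trans (ler_normD _ _)); apply: lerD.
  rewrite normrM ler_wpM2r// ger0_norm.
    by rewrite ler_piMr ?divr_ge0 ?(ltW s0) ?subr_ge0 ?(ltW a1)// /G gerBl.
  by rewrite mulr_ge0 ?divr_ge0 ?(ltW s0) ?subr_ge0 ?(ltW a1).
by rewrite normrM ler_piMl// ger0_norm.
Qed.

Lemma mean_sales0_ge0 (a : R) : 0 < a -> 0 <= mean_sales R k a 0.
Proof.
move=> a0; apply: Rintegral_ge0 => y /=; rewrite in_itv/= andbT => y0.
by rewrite (min_idPr y0) mul0r.
Qed.

Lemma stdPiR_fin (a w z : R) : 0 < a ->
  stdPiR k p a w z = ((a - 1) * (p * mean_sales R k a z - w * z))%:E.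
Proof. by move=> a0; rewrite /stdPiR Expect_minE. Qed.

Lemma stage_equilibrium (fR fM : R -> R) (a : R) : 1 < a -> k^-1 < a ->
  exists (w0 : R) (zs : R -> R),
    [/\ inW wl wh w0,
        forall w, inW wl wh w -> inQ (zs w) /\
          (forall z, inQ z ->
            (stdPiR k p a w z + (stdE k fR z a)%:E
             <= stdPiR k p a w (zs w) + (stdE k fR (zs w) a)%:E)%E) &
        forall w, inW wl wh w ->
          stdPiM c a w (zs w) + stdE k fM (zs w) a
          <= stdPiM c a w0 (zs w0) + stdE k fM (zs w0) a].
Proof.
move=> a1 ak; have a0 : 0 < a by apply: lt_trans a1.
have am1 : 0 < a - 1 by rewrite subr_gt0.
(* Absolute values in the continuation terms make [u] and [v] continuous on the whole plane without
   altering them at feasible orders. *)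
pose u (x : R * R) := (a - 1) * (p * mean_sales R k a x.2 - x.1 * x.2)
                      + stdE k fR `|x.2| a.
pose v (x : R * R) := (a - 1) * (x.1 - c) * x.2 + stdE k fM `|x.2| a.
have uE w z : u (w, z) =
    (a - 1) * (p * mean_sales R k a z - w * z) + stdE k fR `|z| a by [].
have vE w z : v (w, z) = (a - 1) * (w - c) * z + stdE k fM `|z| a by [].
have cstdE (f : R -> R) : continuous (fun x : R * R => stdE k f `|x.2| a).
  move=> x; apply: (@continuous_comp _ _ _ snd (fun z : R => stdE k f `|z| a)).
    exact: cvg_snd.
  exact: continuous_stdE.
have cu : continuous u.
  move=> x; apply: cvgD; last exact: cstdE.
  apply: cvgM; first exact: cvg_cst.
  apply: cvgB; last by apply: cvgM; [exact: cvg_fst|exact: cvg_snd].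
  apply: cvgM; first exact: cvg_cst.
  apply: (@continuous_comp _ _ _ snd (mean_sales R k a)); first exact: cvg_snd.
  exact: continuous_mean_sales.
have cv : continuous v.
  move=> x; apply: cvgD; last exact: cstdE.
  apply: cvgM; last exact: cvg_snd.
  apply: cvgM; first exact: cvg_cst.
  by apply: cvgB; [exact: cvg_fst|exact: cvg_cst].
have [M1 M10 GM1] : exists2 M1, 0 <= M1 & p * Gbar k a 1 M1 <= wl / 2.
  have := cvg_pinfty_Gbar R k k_gt0 a 1 a0 ltr01.
  have wp : 0 < wl / 2 / p by rewrite !divr_gt0.
  move=> /cvgr_lt /(_ _ wp) [M [_ HM]].
  exists (Num.max 0 (M + 1)); first by rewrite le_max lexx.
  have /ltW : Gbar k a 1 (Num.max 0 (M + 1)) < wl / 2 / p.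
    by apply: HM; rewrite lt_max ltrDl ltr01 orbT.
  by rewrite ler_pdivlMr// mulrC.
pose B := (a - 1) / (a - k^-1) * `|fR (a + 1)| + `|fR a|.
have B0 : 0 <= B.
  by rewrite addr_ge0// mulr_ge0// divr_ge0 ?subr_ge0// ltW.
(* [M1] caps the tail of expected sales at half the lowest price, so beyond [M]
   the other half of the purchase cost outweighs all bounded terms. *)
pose M := 2 / wl * (p * M1 + 2 * B / (a - 1)).
have M0 : 0 <= M.
  rewrite mulr_ge0 ?divr_ge0 ?(ltW wl_gt0)// addr_ge0 ?mulr_ge0 ?(ltW p_gt0)//.
  by rewrite invr_ge0 ltW.
have coer w z : wl <= w <= wh -> M < z -> u (w, z) <= u (w, 0).
  move=> /andP[wlw _] Mz; have z0 : 0 <= z by apply: le_trans (ltW Mz).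
  have := mean_sales_le R k k_gt0 a z M1 a0 z0 M10.
  have := mean_sales0_ge0 a a0.
  have := (ler_normlP _ _ (stdE_bounded fR a `|(0 : R)| a1 ak)).1.
  have := (ler_normlP _ _ (stdE_bounded fR a `|z| a1 ak)).2.
  rewrite -/B /u/= mulr0 subr0.
  move: (stdE _ _ _ _) (stdE _ _ _ _) (mean_sales _ _ _ _) (mean_sales _ _ _ _).
  move=> E0 Ez mz m0 EzB E0B m00 mzle.
  have Mz' : p * M1 + 2 * B / (a - 1) <= wl / 2 * z.
    rewrite -ler_pdivrMl; last by rewrite divr_gt0.
    by rewrite invf_div; exact: ltW.
  (* The term [2 * B] pays for the continuation value being as high as [B] at [z] and as low as
     [- B] at 0. *)
  have Mz2 : (a - 1) * (p * M1) + 2 * B <= (a - 1) * (wl / 2 * z).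
    have := ler_wpM2l (ltW am1) Mz'; rewrite mulrDr.
    by rewrite (mulrC (a - 1) (_ / _)) divfK// gt_eqF.
  have h1 : p * mz <= p * M1 + wl / 2 * z.
    have := ler_wpM2l (ltW p_gt0) mzle; have := ler_wpM2r z0 GM1; lra.
  have h2 : wl * z <= w * z by apply: ler_wpM2r.
  have h3 : (a - 1) * (p * mz - w * z) <= (a - 1) * (p * M1 - wl / 2 * z).
    by apply: ler_wpM2l; [exact: ltW|lra].
  have h4 : 0 <= (a - 1) * (p * m0) by rewrite !mulr_ge0// ltW.
  lra.
have [w0 [zs [w0W zsP vP]]] :=
  leader_follower_equilibrium wl wh M u v wlh M0 cu cv coer.
have zs0 w : wl <= w <= wh -> `|zs w| = zs w.
  by move=> /zsP[? _]; rewrite ger0_norm.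
exists w0, zs; split; first exact: w0W.
- move=> w wW; have [zw0 zwmax] := zsP w wW; split; first exact: zw0.
  move=> z z0; rewrite !(stdPiR_fin _ _ _ a0) -!EFinD lee_fin.
  have := zwmax z z0; rewrite !uE (zs0 _ wW) (ger0_norm z0); exact.
- move=> w wW; have := vP w wW; rewrite !vE (zs0 _ wW) (zs0 _ w0W); exact.
Qed.

Lemma inA_gt (a1 a : R) (x : R) : x < a1 -> inA a1 a -> x < a.
Proof. by move=> xa1 [n ->]; rewrite ltr_wpDr. Qed.

Lemma SMPS_exists (a1 : R) (T : nat) : 1 < a1 -> k^-1 < a1 ->
  exists w z, SMPS k p c a1 wl wh T w z.
Proof.
move=> a1_gt1 a1_gtk.
(* One choice fixes a stage solution for every pair [F] of continuation values, the retailer's first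
   and the manufacturer's second; the backward recursion can then be a plain iteration. *)
have /choice[S SP] : forall F : (R -> R) * (R -> R),
    exists S : (R -> R) * (R -> R -> R), forall a, inA a1 a ->
    [/\ inW wl wh (S.1 a),
        forall w, inW wl wh w -> inQ (S.2 a w) /\
          (forall z, inQ z ->
            (stdPiR k p a w z + (stdE k F.1 z a)%:E
             <= stdPiR k p a w (S.2 a w) + (stdE k F.1 (S.2 a w) a)%:E)%E) &
        forall w, inW wl wh w ->
          stdPiM c a w (S.2 a w) + stdE k F.2 (S.2 a w) a
          <= stdPiM c a (S.1 a) (S.2 a (S.1 a)) + stdE k F.2 (S.2 a (S.1 a)) a].
  move=> F.
  have /choice[g gP] : forall a, exists s : R * (R -> R), inA a1 a ->
    [/\ inW wl wh s.1,
        forall w, inW wl wh w -> inQ (s.2 w) /\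
          (forall z, inQ z ->
            (stdPiR k p a w z + (stdE k F.1 z a)%:E
             <= stdPiR k p a w (s.2 w) + (stdE k F.1 (s.2 w) a)%:E)%E) &
        forall w, inW wl wh w ->
          stdPiM c a w (s.2 w) + stdE k F.2 (s.2 w) a
          <= stdPiM c a s.1 (s.2 s.1) + stdE k F.2 (s.2 s.1) a].
    move=> a; have [aA|naA] := pselect (inA a1 a); last by exists (0, fun=> 0).
    have [w0 [zs h]] := stage_equilibrium F.1 F.2 a
      (inA_gt _ _ _ a1_gt1 aA) (inA_gt _ _ _ a1_gtk aA).
    by exists (w0, zs).
  by exists (fun a => (g a).1, fun a => (g a).2).
pose hat (f : R -> R) (z : R -> R -> R) (a w : R) :=
  fine (stdPiR k p a w (z a w) + (stdE k f (z a w) a)%:E)%E.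
pose next (F : (R -> R) * (R -> R)) : (R -> R) * (R -> R) :=
  (fun a => hat F.1 (S F).2 a ((S F).1 a),
   fun a => stdPiM c a ((S F).1 a) ((S F).2 a ((S F).1 a))
            + stdE k F.2 ((S F).2 a ((S F).1 a)) a).
(* [F n] holds the values with [n] periods left: period [t] has values [F (T.+1 - t)] and
   continuation [F (T - t)]. *)
pose F n := iter n next (fun=> 0, fun=> 0).
have FS n : F n.+1 = next (F n) by [].
have hatE f z a w : inA a1 a ->
    (hat f z a w)%:E = (stdPiR k p a w (z a w) + (stdE k f (z a w) a)%:E)%E.
  move=> aA; rewrite /hat fineK// stdPiR_fin//.
  exact: lt_trans ltr01 (inA_gt _ _ _ a1_gt1 aA).
exists (fun t => (S (F (T - t)%N)).1), (fun t => (S (F (T - t)%N)).2).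
exists (fun t => (F (T.+1 - t)%N).1),
  (* Truncated subtraction gives [T - T.+1 = 0], the same index as for period [T], so the terminal
     value 0 has to be imposed by the test. *)
  (fun t a w => if (t <= T)%N then hat (F (T - t)%N).1 (S (F (T - t)%N)).2 a w else 0),
  (fun t => (F (T.+1 - t)%N).2).
split.
  move=> t _; split => [a aA|a w aA wW].
    by have [] := SP (F (T - t)%N) a aA.
  by have [_ /(_ w wW)[]] := SP (F (T - t)%N) a aA.
move=> a w aA wW; split; first by rewrite subnn/= ltnn.
move=> t /andP[_ tT]; rewrite tT subSS (subSn tT) FS.
have [h1 h2 h3] := SP (F (T - t)%N) a aA.
split; first by split; [exact: hatE|exact: (h2 w wW).2].
by split; first by split; [reflexivity|exact: h3].
Qed.

End Existence.

(** * Scaling of the Bellman objectives and monotonicity of orders *)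

Section Scaling.
Variables (R : realType) (k : R).
Hypothesis k_gt0 : 0 < k.

(** Sales and purchase cost both scale by b^(1/k), and the factor [a - 1] built into [stdPiR]
    cancels the divisor of the value functions. *)
Lemma objR_scale (p : R) (f : R -> R) (a b w z : R) :
  1 < a -> k^-1 < a -> 0 < b -> 0 <= z ->
  objR k p (fun a b => b `^ k^-1 / (a - 1) * f a) a b w (b `^ k^-1 * z) =
  ((b `^ k^-1 / (a - 1))%:E * (stdPiR k p a w z + (stdE k f z a)%:E))%E.
Proof.
move=> a1 ak b0 z0; have a0 : 0 < a by apply: lt_trans a1.
rewrite /objR (Expect_continuation R k k_gt0 f a b z a1 ak b0 z0).
rewrite (Expect_min_scale R k k_gt0 a b z a0 b0 z0) (stdPiR_fin R k p k_gt0 a w z a0).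
rewrite (Expect_minE R k k_gt0 a z a0) -!EFinM -EFinB -!EFinD.
congr EFin; field; by rewrite subr_eq0 gt_eqF.
Qed.

Lemma objM_scale (c : R) (f : R -> R) (a b w z : R) :
  1 < a -> k^-1 < a -> 0 < b -> 0 <= z ->
  objM k c (fun a b => b `^ k^-1 / (a - 1) * f a) a b w (b `^ k^-1 * z) =
  (b `^ k^-1 / (a - 1) * (stdPiM c a w z + stdE k f z a))%:E.
Proof.
move=> a1 ak b0 z0.
rewrite /objM (Expect_continuation R k k_gt0 f a b z a1 ak b0 z0) -EFinD.
congr EFin; rewrite /stdPiM; field; by rewrite subr_eq0 gt_eqF.
Qed.

(** Revealed preference: adding the two optimality inequalities cancels revenues and continuation
    values and leaves (a - 1)(w2 - w1)(z1 - z2) >= 0. At equal prices ties could be ordered either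
    way, hence [w1 != w2]. *)
Lemma retailer_order_nonincreasing (p : R) (f : R -> R) (a w1 w2 z1 z2 : R) :
  1 < a -> w1 <= w2 ->
  (stdPiR k p a w1 z2 + (stdE k f z2 a)%:E
   <= stdPiR k p a w1 z1 + (stdE k f z1 a)%:E)%E ->
  (stdPiR k p a w2 z1 + (stdE k f z1 a)%:E
   <= stdPiR k p a w2 z2 + (stdE k f z2 a)%:E)%E ->
  w1 != w2 -> z2 <= z1.
Proof.
move=> a1 w12 h1 h2 w12n; have a0 : 0 < a by apply: lt_trans a1.
move: h1; rewrite (stdPiR_fin R k p k_gt0 a w1 z1 a0) (stdPiR_fin R k p k_gt0 a w1 z2 a0).
rewrite -2!EFinD lee_fin.
move: h2; rewrite (stdPiR_fin R k p k_gt0 a w2 z1 a0) (stdPiR_fin R k p k_gt0 a w2 z2 a0).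
rewrite -2!EFinD lee_fin.
set e1 := stdE _ _ z1 _; set e2 := stdE _ _ z2 _.
set m1 := mean_sales _ _ _ z1; set m2 := mean_sales _ _ _ z2 => h2 h1.
have lt12 : 0 < (a - 1) * (w2 - w1) by rewrite mulr_gt0 ?subr_gt0// lt_neqAle w12n.
by rewrite -subr_ge0 -(pmulr_rge0 _ lt12); lra.
Qed.
End Scaling.

(** * Borel measurability over countably many shapes and monotone orders *)

Section Measurability.
Variable R : realType.

Lemma measurable_inA (a1 : R) : measurable [set a | inA a1 a].
Proof.
rewrite (_ : [set a | _] = \bigcup_n [set a1 + n%:R]).
  by apply: bigcup_measurable => n _; exact: measurable_set1.
by apply/seteqP; split => [x [n ->]|x [n _ /= ->]]; exists n.
Qed.

(** The fibres over the countable set of shapes cover [D], so measurability can be checked with the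
    shape frozen. *)
Lemma measurable_fun_inA d (X : measurableType d) (a1 : R) (D : set X)
    (pi : X -> R) (f : X -> R) :
  measurable D -> measurable_fun setT pi -> (forall x, D x -> inA a1 (pi x)) ->
  (forall n : nat, measurable_fun (D `&` pi @^-1` [set a1 + n%:R]) f) ->
  measurable_fun D f.
Proof.
move=> mD mpi DA mf.
rewrite (_ : D = \bigcup_n (D `&` pi @^-1` [set a1 + n%:R])).
  apply/measurable_fun_bigcup => // n; apply: measurableI => //.
  by rewrite -[X in measurable X]setTI; exact: mpi.
apply/seteqP; split => [x Dx|x [n _ []]//].
by have [n pin] := DA x Dx; exists n.
Qed.

Lemma nonincreasing_on_itv_measurable (wl wh : R) (g : R -> R) : wl <= wh ->
  (forall w1 w2, inW wl wh w1 -> inW wl wh w2 -> w1 <= w2 -> g w2 <= g w1) ->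
  measurable_fun [set w | inW wl wh w] g.
Proof.
(* Clamping to [[wl, wh]] extends [g] to a monotone function on the whole line. *)
move=> wlh gni; pose cl (w : R) := Num.max wl (Num.min w wh).
have clW w : inW wl wh (cl w).
  by rewrite /inW /cl le_max lexx/= ge_max wlh ge_min lexx orbT.
have mW : measurable [set w | inW wl wh w].
  rewrite (_ : [set w | _] = `[wl, wh]%classic); first exact: measurable_itv.
  by apply/seteqP; split => x /=; rewrite in_itv.
apply: (@eq_measurable_fun _ _ _ _ _ (g \o cl)).
  move=> w; rewrite inE /inW/= => /andP[h1 h2].
  by rewrite /cl (min_idPl h2) (max_idPr h1).
apply: nonincreasing_measurable => // w1 w2 w12 /=; apply: gni => //.
rewrite /cl; case: (leP w1 wh); case: (leP w2 wh) => h1 h2;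
  rewrite ge_max le_max lexx/= le_max; apply/orP; right; lra.
Qed.
End Measurability.

(** * From standardized solutions to equilibria *)

Section MainProof.
Variables (R : realType) (k c p : R) (T : nat) (b1 a1 wl wh : R).
Hypotheses (k_gt0 : 0 < k) (b1_gt0 : 0 < b1) (a1_gt1 : 1 < a1) (a1_gtk : k^-1 < a1).
Hypothesis (wlh : wl <= wh).

Lemma scaled_SMPS_measurable (w : nat -> R -> R) (z : nat -> R -> R -> R)
    (fR : nat -> R -> R) (fRh : nat -> R -> R -> R) (fM : nat -> R -> R) :
  SMPS_with k p c a1 wl wh T w z fR fRh fM ->
  markov_strategies a1 b1 wl wh T
    (fun t a b => w t a) (fun t a b w' => b `^ k^-1 * z t a w').
Proof.
move=> [SW SP] t tT; have [tW tQ] := SW t tT.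
have mA := measurable_inA R a1.
have mB : measurable [set b | inB b1 b].
  rewrite (_ : [set b | _] = `[b1, +oo[%classic); first exact: measurable_itv.
  by apply/seteqP; split => x /=; rewrite in_itv/= andbT.
have mW : measurable [set w | inW wl wh w].
  rewrite (_ : [set w | _] = `[wl, wh]%classic); first exact: measurable_itv.
  by apply/seteqP; split => x /=; rewrite in_itv.
have mAB : measurable ([set a | inA a1 a] `*` [set b | inB b1 b]).
  exact: measurableX.
have mABW : measurable
    (([set a | inA a1 a] `*` [set b | inB b1 b]) `*` [set w' | inW wl wh w']).
  exact: measurableX.
split; [|split; [|split]].
- apply: (@measurable_fun_inA _ _ _ a1 _ fst) => //.
    by move=> x [].
  move=> n; apply: (@eq_measurable_fun _ _ _ _ _ (cst (w t (a1 + n%:R)))).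
    by move=> x; rewrite inE => -[_ /= ->].
  exact: measurable_cst.
- apply: (@measurable_fun_inA _ _ _ a1 _ (fst \o fst)) => //.
    by apply: measurableT_comp.
    by move=> x [[]].
  move=> n.
  apply: (@eq_measurable_fun _ _ _ _ _
      (fun x : (R * R) * R => x.1.2 `^ k^-1 * z t (a1 + n%:R) x.2)).
    by move=> x; rewrite inE => -[_ /= ->].
  have aA : inA a1 (a1 + n%:R) by exists n.
  apply: measurable_funM.
    apply: measurable_funTS; apply: (measurableT_comp (measurable_powR _)).
    by apply: measurableT_comp.
  (* With the shape frozen, the standardized order depends on the price alone and is monotone in it;
     equal prices are treated apart because revealed preference compares distinct ones. *)
  apply: (@measurable_comp _ _ _ _ _ _ [set w' | inW wl wh w']) => //.
  + by move=> _ [x [[_ xW] _] <-].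
  + apply: nonincreasing_on_itv_measurable => // w1 w2 w1W w2W.
    have [->//|w12n] := eqVneq w1 w2; move=> w12.
    have [_ /(_ t tT)[[_ max1] _]] := SP _ _ aA w1W.
    have [_ /(_ t tT)[[_ max2] _]] := SP _ _ aA w2W.
    apply: (retailer_order_nonincreasing R k k_gt0 p (fR t.+1) (a1 + n%:R) w1 w2
      _ _ _ w12 (max1 _ (tQ _ _ aA w2W)) (max2 _ (tQ _ _ aA w1W)) w12n).
    exact: inA_gt a1_gt1 aA.
  + by apply: measurable_funTS.
- by move=> a b aA _; exact: tW.
- by move=> a b w' aA _ wW; rewrite /inQ mulr_ge0 ?powR_ge0//; exact: tQ.
Qed.

Lemma scaled_SMPS_MPE (w : nat -> R -> R) (z : nat -> R -> R -> R)
    (fR : nat -> R -> R) (fRh : nat -> R -> R -> R) (fM : nat -> R -> R) :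
  SMPS_with k p c a1 wl wh T w z fR fRh fM ->
  MPE_with k p c a1 b1 wl wh T
    (fun t a b => w t a)
    (fun t a b w' => b `^ k^-1 * z t a w')
    (fun t a b => b `^ k^-1 / (a - 1) * fR t a)
    (fun t a b w' => b `^ k^-1 / (a - 1) * fRh t a w')
    (fun t a b => b `^ k^-1 / (a - 1) * fM t a).
Proof.
move=> S; split; first exact: scaled_SMPS_measurable S.
case: S => SW SP a b w' aA bB wW.
have [[fR0 [fRh0 fM0]] St] := SP a w' aA wW.
split; first by rewrite fR0 fRh0 fM0 mulr0.
move=> t tT; have [[RE Rmax] [[ME Mmax] RRh]] := St t tT.
have [tW tQ] := SW t tT.
have a_gt1 : 1 < a := inA_gt R a1 a 1 a1_gt1 aA.
have a_gtk : k^-1 < a := inA_gt R a1 a k^-1 a1_gtk aA.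
have b0 : 0 < b := lt_le_trans b1_gt0 bB.
have s0 : 0 < b `^ k^-1 by exact: powR_gt0.
have s1 : 0 < b `^ k^-1 / (a - 1) by rewrite divr_gt0// subr_gt0.
have zR u : inW wl wh u -> 0 <= z t a u by exact: tQ.
have oR u v : 0 <= v -> _ := objR_scale R k k_gt0 p (fR t.+1) a b u v a_gt1 a_gtk b0.
have oM u v : 0 <= v -> _ := objM_scale R k k_gt0 c (fM t.+1) a b u v a_gt1 a_gtk b0.
split; [split|split; [split|]].
- by rewrite oR; [rewrite EFinM RE|exact: zR].
(* Every deviation [q'] is the scaling of a feasible standardized order, so no deviation escapes the
   standardized optimality condition. *)
- move=> q' q'0; have qE : q' = b `^ k^-1 * (q' / b `^ k^-1).
    by rewrite mulrC divfK// gt_eqF.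
  have zq0 : 0 <= q' / b `^ k^-1 by rewrite divr_ge0// ltW.
  rewrite {1}qE (oR _ _ zq0) (oR _ _ (zR _ wW)).
  by apply: lee_wpmul2l; [rewrite lee_fin ltW|exact: Rmax].
- by rewrite oM; [rewrite ME|exact/zR/tW].
- move=> w'' w''W; rewrite (oM _ _ (zR _ w''W)) (oM _ _ (zR _ (tW _ aA))) lee_fin.
  by apply: ler_wpM2l; [exact: ltW|exact: Mmax].
- by rewrite RRh.
Qed.
End MainProof.

Theorem theorem1 (R : realType) (k c p : R) (T : nat) (b1 a1 wl wh : R) :
  0 < k -> 0 < c -> c < p -> (1 <= T)%N -> 0 < b1 -> 1 < a1 -> k^-1 < a1 ->
  0 < wl -> wl <= c -> p <= wh ->
  (exists w z, SMPS k p c a1 wl wh T w z) /\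
  (exists w q, MPE k p c a1 b1 wl wh T w q) /\
  (forall (w : nat -> R -> R) (z : nat -> R -> R -> R)
          (fR : nat -> R -> R) (fRh : nat -> R -> R -> R) (fM : nat -> R -> R),
     SMPS_with k p c a1 wl wh T w z fR fRh fM ->
     MPE_with k p c a1 b1 wl wh T
       (fun t a b => w t a)
       (fun t a b w' => b `^ k^-1 * z t a w')
       (fun t a b => b `^ k^-1 / (a - 1) * fR t a)
       (fun t a b w' => b `^ k^-1 / (a - 1) * fRh t a w')
       (fun t a b => b `^ k^-1 / (a - 1) * fM t a)).
Proof.
move=> k0 c0 cp _ b10 a11 a1k wl0 wlc pwh.
have p0 : 0 < p := lt_trans c0 cp.
have wlh : wl <= wh := le_trans wlc (le_trans (ltW cp) pwh).
have [w [z [fR [fRh [fM S]]]]] := SMPS_exists R k p c wl wh k0 p0 wl0 wlh a1 T a11 a1k.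
have scaled := scaled_SMPS_MPE R k c p T b1 a1 wl wh k0 b10 a11 a1k wlh.
split; [|split].
- by exists w, z, fR, fRh, fM.
- exists (fun t a b => w t a), (fun t a b w' => b `^ k^-1 * z t a w').
  by do 3 eexists; exact: scaled S.
- exact: scaled.
Qed.
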